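(* Let $K$ be an algebraically closed field, let $n\ge 3$ be an odd integer, and suppose that $\mathrm{char}(K)\ne 2$ and $\mathrm{char}(K)\nmid n+1$. Let $\ell_0=(n+1)/2$, and let $C\in K^*$ be such that either $C=1$ or $C^{n+1}\ne 1$. Then for each $\ell_0$-element subset $I\subset\mu_{n+1}$ there are only finitely many values of $\lambda\in K^*$ such that the polynomial $$x^{n+1}-\tilde u(x)^2,\qquad\text{where}\quad \tilde u(x)=\frac{\lambda H_I(x)-(1/\lambda)H_{\complement I}(x)}{2C^{\ell_0}},$$ has a multiple root.
   Context: $\mu_{n+1}$ is the set of all $(n+1)$-th roots of $1$ in $K$. For a subset $I\subset\mu_{n+1}$, $\complement I=\mu_{n+1}\setminus I$ is its complement and $$H_I(x)=\prod_{\varepsilon\in I}\bigl((1-C\varepsilon)x+1\bigr),\qquad H_{\complement I}(x)=\prod_{\varepsilon\in \complement I}\bigl((1-C\varepsilon)x+1\bigr).$$ *)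

(* Defs.v *)
From HB Require Import structures.
From mathcomp Require Import all_boot all_order all_algebra.
From mathcomp Require Import boolp classical_sets functions cardinality fsbigop.

Set Implicit Arguments.
Unset Strict Implicit.
Unset Printing Implicit Defensive.

Import GRing.Theory.
Local Open Scope classical_set_scope.
Local Open Scope ring_scope.

Definition mu (K : fieldType) (m : nat) : set K := [set e | m.-unity_root e].
Arguments mu : clear implicits.

(* The big operator over a classical set is the genuine product only when the
   set of indices with factor different from 1 is finite (and is 1 otherwise);
   J is meant to be a subset of [mu K m] with 0 < m, hence finite. *)
Definition Hpoly (K : fieldType) (C : K) (J : set K) : {poly K} :=
  \big[*%R/1]_(e \in J) ((1 - C * e) *: 'X + 1).

(* The exponent of C is (n + 1) / 2; only odd n is relevant. *)
Definition utilde (K : fieldType) (n : nat) (C : K) (I : set K) (lambda : K) :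
    {poly K} :=
  (2 * C ^+ n.+1./2)^-1 *:
    (lambda *: Hpoly C I - lambda^-1 *: Hpoly C (mu K n.+1 `\` I)).

(* Not [1 < mup a p], as [mup a 0] is 0: every element is to be a multiple root
   of the zero polynomial. *)
Definition has_multiple_root (K : fieldType) (p : {poly K}) : Prop :=
  exists a : K, ('X - a%:P) ^+ 2 %| p.

(* Main.v *)
Require Import Defs.
From HB Require Import structures.
From mathcomp Require Import all_boot all_order all_algebra all_field.
From mathcomp Require Import boolp classical_sets functions cardinality fsbigop.
From mathcomp Require Import ring.
Import GRing.Theory.
Local Open Scope classical_set_scope.
Local Open Scope ring_scope.

(* Write n + 1 = 2l and split H_I = A1 A2, and likewise B1 B2 for the
   complement of I, according to whether e^l = 1 or e^l = -1, so that
   A1 B1 = (x+1)^l - (C x)^l and A2 B2 = (x+1)^l + (C x)^l. Then x^l - u(x)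
   is, up to a nonzero constant, (t A1 - B2) (t A2 + B1), where t is lambda,
   and x^l + u(x) is obtained from it by t -> -t. Two of the four
   factors of x^(n+1) - u^2 can only have a common root at x = -1 or at x = 0,
   which determines t up to sign. A multiple root of t P - Q, with
   P Q separable, is a zero of the Wronskian of P and Q,
   which vanishes identically only if P and Q are constant; this holds in every
   characteristic. *)

Lemma has_multiple_root_deriv (K : fieldType) (p : {poly K}) :
  has_multiple_root p -> exists a, p.[a] = 0 /\ p^`().[a] = 0.
Proof.
case=> a /dvdpP [q ->]; exists a.
rewrite derivM deriv_exp !hornerE subrr expr0n /= mulr0n.
by rewrite !(mul0r, mulr0, mul0rn, addr0).
Qed.

(** If a is not a root of one factor, then (X - a)^2 is coprime to that factor and divides the other
    one. *)
Lemma has_multiple_rootM (K : fieldType) (p q : {poly K}) :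
  has_multiple_root (p * q) ->
  [\/ has_multiple_root p, has_multiple_root q
    | exists a, p.[a] = 0 /\ q.[a] = 0].
Proof.
case=> a dvd_pq.
have [rp|nrp] := boolP (root p a); last first.
  apply: Or32; exists a; rewrite -(Gauss_dvdpr _ (q := p)) //.
  by rewrite coprimep_expl // coprimep_sym coprimep_XsubC.
have [rq|nrq] := boolP (root q a); last first.
  apply: Or31; exists a; rewrite -(Gauss_dvdpl _ (q := q)) //.
  by rewrite coprimep_expl // coprimep_sym coprimep_XsubC.
by apply: Or33; exists a; split; apply/eqP.
Qed.

Lemma has_multiple_rootZ (K : fieldType) (c : K) (p : {poly K}) :
  c != 0 -> has_multiple_root (c *: p) <-> has_multiple_root p.
Proof. by move=> c0; split=> -[a dvd_a]; exists a; move: dvd_a; rewrite dvdpZr. Qed.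

Lemma finite_multiple_root_pencil (K : closedFieldType) (P Q : {poly K}) :
  separable_poly (P * Q) ->
  finite_set [set t : K | has_multiple_root (t *: P - Q)].
Proof.
rewrite separable_mul !separable_poly.unlock => /and3P[sepP sepQ coPQ].
pose W := P * Q^`() - P^`() * Q.
pose f x := Q.[x] / P.[x].
(* A zero of P at x would also be one of Q, against coprimality; so the point x determines t. *)
have PQ x t : t * P.[x] = Q.[x] -> t = f x.
  move=> eqx; have Px : P.[x] != 0.
    apply: contraTneq isT => Px0.
    have /(coprimep_root coPQ) : root P x by apply/rootP.
    by rewrite -eqx Px0 mulr0 eqxx.
  by rewrite /f -eqx mulfK.
(* If W = 0, a root of P would be a root of P' Q, although P is separable and coprime to Q. So P has
   no root and is constant, and then so is Q; a constant has a multiple root only if it is 0. *)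
have [W0|Wn0] := eqVneq W 0.
  have W0x x : P.[x] * Q^`().[x] = P^`().[x] * Q.[x].
    by apply/eqP; rewrite -subr_eq0 -!hornerM -hornerN -hornerD -/W W0 horner0.
  have /size_poly1P[p p0 eP] : size P == 1.
    apply: contraTT isT => /closed_rootP[x Px].
    have := W0x x; rewrite (rootP Px) mul0r => /esym/eqP.
    rewrite mulf_eq0 (negPf (coprimep_root sepP Px)).
    by rewrite (negPf (coprimep_root coPQ Px)).
  have /size_poly1P[q q0 eQ] : size Q == 1.
    apply: contraTT isT => /closed_rootP[x Qx].
    have := W0x x; rewrite (rootP Qx) mulr0 => /eqP.
    rewrite mulf_eq0 (negPf (coprimep_root sepQ Qx)) orbF eP hornerC.
    by rewrite (negPf p0).
  apply: (@sub_finite_set _ _ [set q / p]); last exact: finite_set1.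
  move=> t /= /has_multiple_root_deriv [x [+ _]].
  rewrite eP eQ !hornerE => /eqP; rewrite subr_eq0 => /eqP <-.
  by rewrite mulfK.
have [rs Wrs] := closed_field_poly_normal W.
apply: (@sub_finite_set _ _ [set f x | x in [set` rs]]); last first.
  exact/finite_image/finite_seq.
move=> t /= /has_multiple_root_deriv [x [tx tx']].
have {}tx : t * P.[x] = Q.[x].
  by apply/eqP; rewrite -subr_eq0; move: tx; rewrite !hornerE => ->.
have {}tx' : t * P^`().[x] = Q^`().[x].
  by apply/eqP; rewrite -subr_eq0; move: tx'; rewrite derivB derivZ !hornerE => ->.
rewrite (PQ _ _ tx).
exists x => //=; have : root W x.
  by apply/rootP; rewrite /W !hornerE -tx -tx'; ring.
by rewrite Wrs rootZ ?lead_coef_eq0 // root_prod_XsubC.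
Qed.

(** Homogenization: evaluate the factorization at a / b and multiply by b^l. For b = 0 both sides
    are a^l, as there are l roots. The morphism [phi] keeps the roots in K while a and b lie in a
    larger field. *)
Lemma subXn_prod (K L : fieldType) (phi : {rmorphism K -> L}) (l : nat)
    (c : K) (rs : seq K) (a b : L) :
  (0 < l)%N -> 'X^l - c%:P = \prod_(r <- rs) ('X - r%:P) ->
  a ^+ l - phi c * b ^+ l = \prod_(r <- rs) (a - phi r * b).
Proof.
move=> l0 E.
have szrs : size rs = l.
  have := congr1 (fun p : {poly K} => size p) E.
  by rewrite size_prod_XsubC size_XnsubC // => -[].
have [-> | b0] := eqVneq b 0.
  rewrite expr0n eqn0Ngt l0 mulr0 subr0.
  under eq_bigr do rewrite mulr0 subr0.
  by rewrite big_const_seq iter_mulr_1 count_predT szrs.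
have := congr1 (fun p => (map_poly phi p).[a / b] * b ^+ l) E.
rewrite rmorphB rmorph_prod /= map_polyXn map_polyC /= horner_prod !hornerE.
rewrite mulrBl -exprMn divfK // => ->.
rewrite -[in b ^+ l]szrs -count_predT -iter_mulr_1 -big_const_seq -big_split /=.
apply: eq_bigr => r _; rewrite map_polyXsubC !hornerE mulrBl divfK //.
Qed.

Lemma subXn_prod_poly (K : fieldType) (l : nat) (c : K) (rs : seq K)
    (p q : {poly K}) :
  (0 < l)%N -> 'X^l - c%:P = \prod_(r <- rs) ('X - r%:P) ->
  p ^+ l - c *: q ^+ l = \prod_(r <- rs) (p - r *: q).
Proof.
(* The division by q takes place in the fraction field of K[X]. *)
move=> l0 E; apply/eqP; rewrite -tofrac_eq; apply/eqP.
rewrite rmorph_prod /= -mul_polyC rmorphB rmorphM !rmorphXn /=.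
rewrite (subXn_prod _ _ (@tofrac {poly K} \o @polyC K) _ c rs _ _ l0 E).
by apply: eq_bigr => r _; rewrite -mul_polyC rmorphB rmorphM.
Qed.

Lemma Xn_subC_prod_XsubC (K : closedFieldType) (l : nat) (c : K) :
  (0 < l)%N -> exists rs : seq K, 'X^l - c%:P = \prod_(r <- rs) ('X - r%:P).
Proof.
move=> l0; have [rs E] := closed_field_poly_normal ('X^l - c%:P).
by exists rs; rewrite E (monicP (monicXnsubC c l0)) scale1r.
Qed.

(** At a common root x with the derivative, (x+1)^m = d x^m and (x+1)^(m-1) = d x^(m-1). Multiplying
    the latter by x+1 and subtracting gives d x^(m-1) = 0, and x = 0 would make the second equation
    read 1 = 0. Degrees do not enter, so d = 1, where the leading terms cancel, is covered. *)
Lemma separable_subXn (K : closedFieldType) (m : nat) (d : K) :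
  m%:R != 0 :> K -> d != 0 ->
  separable_poly (('X + 1) ^+ m - d *: 'X^m : {poly K}).
Proof.
case: m => [|m] m0 d0; first by rewrite eqxx in m0.
rewrite separable_poly.unlock; apply/Pdiv.ClosedField.coprimepP => x /rootP.
rewrite derivB deriv_exp derivZ derivXn derivD derivX derivC addr0 mul1r.
rewrite !hornerE /= => /eqP; rewrite subr_eq0 => /eqP Dx.
apply: contra_neq d0 => /eqP.
rewrite hornerMn !hornerE hornerMn !hornerE /= mulrnAr -mulrnBl -mulr_natr.
rewrite mulf_eq0 (negPf m0) orbF subr_eq0 => /eqP D'x.
move/eqP: Dx; rewrite exprSr D'x exprSr mulrA -subr_eq0 -mulrBr addrAC subrr add0r.
rewrite mulr1 mulf_eq0 expf_eq0 => /orP[/eqP //|/andP[m_gt0 /eqP x0]].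
move/eqP: D'x; rewrite x0 add0r expr1n expr0n eqn0Ngt m_gt0 mulr0.
by rewrite oner_eq0.
Qed.

Lemma finite_multiple_root_quadratic (K : closedFieldType) (l : nat)
    (A1 A2 B1 B2 : {poly K}) :
  2 != 0 :> K ->
  separable_poly (A1 * A2 * B1 * B2) ->
  A1 * B1 + A2 * B2 = 2 *: ('X + 1) ^+ l ->
  finite_set [set t : K |
    has_multiple_root ((t *: A1 - B2) * (t *: A2 + B1))].
Proof.
move=> n2 sep sumAB.
have sep12 : separable_poly (A1 * B2).
  by apply: dvdp_separable sep; rewrite mulrAC dvdp_mulr // mulrAC dvdp_mulr.
have sep21 : separable_poly (A2 * - B1).
  apply: dvdp_separable sep.
  by rewrite mulrN dvdpNl dvdp_mulr // -mulrA dvdp_mull.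
apply: (@sub_finite_set _ _ ([set t | has_multiple_root (t *: A1 - B2)] `|`
  [set t | has_multiple_root (t *: A2 - - B1)] `|`
  [set B2.[-1] / A1.[-1]])); last first.
  rewrite !finite_setU; split; last exact: finite_set1.
  by split; apply: finite_multiple_root_pencil.
move=> t /= /has_multiple_rootM [?|?|[x [e1 e2]]].
- by left; left.
- by left; right; rewrite opprK.
right.
have e1' : t * A1.[x] = B2.[x].
  by apply/eqP; rewrite -subr_eq0; move: e1; rewrite !hornerE => ->.
have e2' : t * A2.[x] = - B1.[x].
  by apply/eqP; rewrite -subr_eq0 opprK; move: e2; rewrite !hornerE => ->.
(* Substituting B2 = t A1 and B1 = - t A2 at x makes the left side of [sumAB] vanish. *)
have x1 : x = -1.
  have : 2 * (x + 1) ^+ l = 0.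
    have := congr1 (horner^~ x) sumAB; rewrite !hornerE => <-.
    by rewrite -e1' -[B1.[x]]opprK -e2'; ring.
  move/eqP; rewrite mulf_eq0 (negPf n2) expf_eq0 => /andP[_].
  by rewrite addr_eq0 => /eqP.
have Ax : A1.[x] != 0.
  apply: contraTneq isT => Ax0.
  move: sep12; rewrite separable_mul => /and3P[_ _ /coprimep_root co].
  by have := co x (introT rootP Ax0); rewrite -e1' Ax0 mulr0 eqxx.
by rewrite -x1 -e1' mulfK.
Qed.

Theorem theorem7 (K : closedFieldType) (n : nat) (C : K) (I : set K)
  (n_ge3 : (3 <= n)%N) (n_odd : odd n)
  (char_neq2 : 2%N \notin [pchar K])
  (char_ndvd : forall p : nat, p \in [pchar K] -> ~~ (p %| n.+1)%N)
  (C_neq0 : C != 0) (C_cond : C = 1 \/ C ^+ n.+1 <> 1)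
  (I_sub : I `<=` mu K n.+1) (I_card : (I #= `I_(n.+1./2))%card) :
  finite_set [set lambda : K | lambda != 0 /\
    has_multiple_root ('X^(n.+1) - utilde n C I lambda ^+ 2)].
Proof.
have n2 : 2 != 0 :> K by move: char_neq2; rewrite inE.
have n0 : n.+1%:R != 0 :> K.
  rewrite natf_neq0_pchar; apply/andP; split=> //; apply/allP => p.
  by rewrite mem_primes => /and3P[_ _ pn]; apply/negP => /char_ndvd; rewrite pn.
rewrite /utilde; set l := n.+1./2.
have nl : n.+1 = (l * 2)%N.
  by rewrite muln2 /l -[LHS]odd_double_half /= n_odd.
have l0 : (0 < l)%N by move: nl; case: (l).
(* [rs1] and [rs2] list the e with e^l = 1 and with e^l = -1; together they list the (n+1)-th roots
   of 1. *)
have [rs1 E1] := @Xn_subC_prod_XsubC K l 1 l0.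
have [rs2 E2] := @Xn_subC_prod_XsubC K l (-1) l0.
have Ers : 'X^(n.+1) - 1 = \prod_(r <- rs1 ++ rs2) ('X - r%:P).
  by rewrite big_cat /= -E1 -E2 nl exprM polyCN; ring.
(* Without repetitions, products over the sets I and its complement become products over filtered
   lists. *)
have u_rs : uniq (rs1 ++ rs2).
  by rewrite -separable_prod_XsubC -Ers separable_Xn_sub_1.
have mu_rs : mu K n.+1 = [set` rs1 ++ rs2].
  apply/seteqP; split=> e; rewrite /mu /= /root_of_unity Ers root_prod_XsubC //.
pose h e : {poly K} := (1 - C * e) *: 'X + 1.
(* In this form a product over [rs1] or [rs2] is a factored difference or sum of l-th powers. *)
have hE e : h e = ('X + 1) - e *: (C *: 'X).
  by rewrite /h scalerBl scale1r scalerA mulrC addrAC.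
pose A s := \prod_(e <- s | e \in I) h e.
pose B s := \prod_(e <- s | e \notin I) h e.
have AB s : A s * B s = \prod_(e <- s) (('X + 1) - e *: (C *: 'X)).
  rewrite [RHS](bigID (fun e => e \in I)) /=.
  by congr (_ * _); apply: eq_bigr => e _.
have HA : Hpoly C I = A rs1 * A rs2.
  have eI : I = [set` [seq e <- rs1 ++ rs2 | e \in I]].
    apply/seteqP; split=> e /=; rewrite mem_filter.
      by move=> Ie; rewrite mem_set //; have := I_sub _ Ie; rewrite mu_rs.
    by case/andP => /set_mem.
  by rewrite /Hpoly {1}eI -fsbig_seq ?filter_uniq // big_filter big_cat.
have HB : Hpoly C (mu K n.+1 `\` I) = B rs1 * B rs2.
  have eI : mu K n.+1 `\` I = [set` [seq e <- rs1 ++ rs2 | e \notin I]].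
    apply/seteqP; rewrite mu_rs; split=> e /=; rewrite mem_filter.
      by case=> -> nIe; rewrite andbT; apply/negP => /set_mem.
    by case/andP => nIe ->; split=> // /mem_set Ie; rewrite Ie in nIe.
  by rewrite /Hpoly eI -fsbig_seq ?filter_uniq // big_filter big_cat.
rewrite HA HB.
pose Y : {poly K} := (C *: 'X) ^+ l.
have AB1 : A rs1 * B rs1 = ('X + 1) ^+ l - Y.
  by rewrite AB -(subXn_prod_poly _ _ _ _ _ _ l0 E1) scale1r.
have AB2 : A rs2 * B rs2 = ('X + 1) ^+ l + Y.
  by rewrite AB -(subXn_prod_poly _ _ _ _ _ _ l0 E2) scaleN1r opprK.
pose G t := (t *: A rs1 - B rs2) * (t *: A rs2 + B rs1).
have Gfin : finite_set [set t | has_multiple_root (G t)].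
  apply: (finite_multiple_root_quadratic _ l) => //.
    have -> : A rs1 * A rs2 * B rs1 * B rs2 = ('X + 1) ^+ n.+1 - C ^+ n.+1 *: 'X^(n.+1).
      rewrite -[_ * B rs1 * _]mulrA mulrACA AB1 AB2 -exprZn nl !exprM -/Y.
      ring.
    by apply: separable_subXn => //; rewrite expf_neq0.
  by rewrite AB1 AB2 scaler_nat; ring.
(* The three sets account for a multiple root of x^l - u, one of x^l + u, and a root common to
   both. *)
apply: (@sub_finite_set _ _ ([set t | has_multiple_root (G t)] `|`
    [set - t | t in [set t | has_multiple_root (G t)]] `|` [set 1; -1])).
  move=> t /= [t0].
  (* Multiplying by [c] clears the denominators of u, both 2 C^l and t. *)
  pose c := 2 * C ^+ l * t.
  have c0 : c != 0 by rewrite !mulf_neq0 ?expf_neq0.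
  set u := (X in _ - X ^+ 2).
  have uE : c *: u = t ^+ 2 *: (A rs1 * A rs2) - B rs1 * B rs2.
    rewrite /u scalerA /c mulrAC mulrV ?mul1r; last first.
      by rewrite unitfE mulf_neq0 ?expf_neq0.
    by rewrite scalerBr !scalerA mulfV // scale1r.
  clearbody u.
  have XE : c *: 'X^l = (2 * t) *: Y.
    by rewrite /Y exprZn scalerA mulrAC.
  (* The coefficient of s in [G s] is A1 B1 - A2 B2 = -2 Y. *)
  have GE s : G s = s ^+ 2 *: (A rs1 * A rs2) - (2 * s) *: Y - B rs1 * B rs2.
    have -> : (2 * s) *: Y = s *: (A rs2 * B rs2 - A rs1 * B rs1).
      by rewrite AB1 AB2 -!mul_polyC rmorphM /= polyC_natr; ring.
    by rewrite /G -!mul_polyC; ring.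
  have G1 : c *: ('X^l - u) = - G t.
    by rewrite scalerBr XE uE GE; ring.
  have G2 : c *: ('X^l + u) = G (- t).
    by rewrite scalerDr XE uE GE sqrrN mulrN scaleNr; ring.
  have -> : 'X^(n.+1) - u ^+ 2 = ('X^l - u) * ('X^l + u).
    by rewrite nl exprM; ring.
  case/has_multiple_rootM => [|| [x [e1 e2]]].
  - move=> /(has_multiple_rootZ _ _ _ c0).
    rewrite G1 => -[a]; rewrite dvdpNr => Ha; left; left; by exists a.
  - move=> /(has_multiple_rootZ _ _ _ c0); rewrite G2 => Gt.
    by left; right; exists (- t) => //; rewrite opprK.
  (* The two factors add up to 2 x^l. *)
  have x0 : x = 0.
    have : 2 * x ^+ l = 0.
      rewrite -[RHS](addr0 0) -[X in _ = X + _]e1 -[X in _ = _ + X]e2.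
      by rewrite !(hornerD, hornerN, hornerXn); ring.
    by move/eqP; rewrite mulf_eq0 (negPf n2) expf_eq0 => /andP[_ /eqP].
  (* All the products are 1 at 0, so [uE] evaluated there reads 0 = t^2 - 1. *)
  have h0 e : (h e).[0] = 1 by rewrite /h !hornerE.
  have u0 : u.[0] = 0 by move: e2; rewrite x0 !hornerE expr0n eqn0Ngt l0 add0r.
  have A0 s : (A s).[0] = 1 by rewrite horner_prod big1 // => e _; exact: h0.
  have B0 s : (B s).[0] = 1 by rewrite horner_prod big1 // => e _; exact: h0.
  have := congr1 (horner^~ 0) uE.
  rewrite !(hornerD, hornerN, hornerZ, hornerM) u0 !A0 !B0 !mulr1 mulr0.
  move/esym/eqP; rewrite subr_eq0 sqrf_eq1 => /orP[]/eqP t1; first by right; left.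
  by right; right.
rewrite !finite_setU; split; last by split; exact: finite_set1.
by split=> //; exact: finite_image.
Qed.
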